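(* Let $f:\mathbb{R}^n\to\mathbb{R}$ satisfy the standing assumption in the context. Consider the SLO algorithm with the gradient projection subroutine $$x_{k+1}^\tau=\mathcal{A}_{GP}\big(f,x_k^\tau,x_0^\tau,(L_1^\tau)^{-1},D\big),\qquad L_1^\tau=\mathcal{L}_1(B(x_0^\tau,D)),$$ with $d=0$ and $D\ge\frac{\sqrt\epsilon}{2}$. Put $\Delta_f:=f(x_0^1)-f^*$ and $R_T:=\frac{4\Delta_f}{\sqrt\epsilon}+D$. Then the algorithm takes at most $T=\left\lceil\frac{4\Delta_f}{\sqrt\epsilon D}+1\right\rceil$ epochs to output a point $x_k^\tau$ with $\|\nabla f(x_k^\tau)\|^2\le\epsilon$. Moreover, the total number of gradient evaluations is at most $$\sum_{\tau=1}^TK_\tau\le\mathcal{O}\Big(\frac{\Delta_f}{\epsilon}\cdot\mathcal{L}_1\big(B(x_0^1,R_T)\big)\Big),$$ where $\mathcal{O}(\cdot)$ hides an absolute constant.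
   Context: Norms are Euclidean and $B(x,r)=\{y:\|y-x\|\le r\}$. Standing assumption: $f$ is continuously differentiable, $f^*:=\inf_xf(x)>-\infty$, and $\nabla f$ is locally but not globally Lipschitz. For each compact $C\subsetneq\mathbb{R}^n$, $\mathcal{L}_1(C)\ge1$ denotes the Lipschitz constant of $\nabla f$ on $C$, i.e. $\|\nabla f(x)-\nabla f(y)\|\le\mathcal{L}_1(C)\|x-y\|$ for $x,y\in C$; it is monotone in $C$. The values of $\mathcal{L}_1$ on the balls used by the algorithm are available to it. Gradient projection subroutine: for $\eta,r>0$ and $x\in B(\bar x,r)$, $\mathcal{A}_{GP}(f,x,\bar x,\eta,r)$ is the Euclidean projection of $x-\eta\nabla f(x)$ onto $B(\bar x,r)$, i.e. it equals $x-\eta\nabla f(x)$ if this lies in $B(\bar x,r)$, and $\bar x+r\frac{x-\eta\nabla f(x)-\bar x}{\|x-\eta\nabla f(x)-\bar x\|}$ otherwise. SLO algorithm (with $d=0$ here). Inputs: $x_0^1$, $\epsilon>0$, $D>0$, $d\ge 0$. For epochs $\tau=1,2,\dots$: compute $L_1^\tau$. For $k=0,1,2,\dots$: (a) if $\|\nabla f(x_k^\tau)\|<\sqrt\epsilon$, terminate and return $x_k^\tau$; (b) compute $x_{k+1}^\tau$ by the subroutine; (c) if $\|x_{k+1}^\tau-x_0^\tau\|\in[D-d,D]$, set $x_0^{\tau+1}=x_{k+1}^\tau$, end epoch $\tau$ and start epoch $\tau+1$. $K_\tau$ is the index of the last iterate of epoch $\tau$; each execution of the subroutine costs one gradient evaluation.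 *)

(* Defs.v *)
From HB Require Import structures.
From mathcomp Require Import all_boot all_order all_algebra.
From mathcomp Require Import all_classical all_reals all_analysis.
Import Order.TTheory GRing.Theory Num.Theory.
Import numFieldNormedType.Exports.

Set Implicit Arguments.
Unset Strict Implicit.
Unset Printing Implicit Defensive.

Local Open Scope classical_set_scope.
Local Open Scope ring_scope.

(* The library's norm [`|x|] on ['rV[R]_n] is the sup norm; all norms below are
   Euclidean.  Both induce the same topology, so [compact], [continuous] and
   [differentiable] are the library's. *)
Definition enorm (R : realType) (n : nat) (x : 'rV[R]_n) : R :=
  Num.sqrt (\sum_(i < n) x 0 i ^+ 2).

Definition eball (R : realType) (n : nat) (x : 'rV[R]_n) (r : R) :
    set 'rV[R]_n :=
  [set y | enorm (y - x) <= r].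

Definition grad (R : realType) (n : nat) (f : 'rV[R]_n -> R) (x : 'rV[R]_n) :
    'rV[R]_n :=
  \row_(i < n) 'D_(delta_mx 0 i) f x.

Definition elipschitz (R : realType) (n : nat) (g : 'rV[R]_n -> 'rV[R]_n)
    (A : set 'rV[R]_n) (L : R) : Prop :=
  forall x y, A x -> A y -> enorm (g x - g y) <= L * enorm (x - y).

Record standing_assumption (R : realType) (n : nat) (f : 'rV[R]_n -> R) :
    Prop := {
  sa_differentiable : forall x, differentiable f x;
  sa_grad_continuous : continuous (grad f);
  sa_bounded_below : has_lbound (range f);
  sa_locally_lipschitz : forall x : 'rV[R]_n,
    exists2 r : R, 0 < r & exists L : R, elipschitz (grad f) (eball x r) L;
  sa_not_lipschitz : ~ exists L : R, elipschitz (grad f) setT L }.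

(* [L1] need not give the least admissible constants: any monotone assignment
   of valid Lipschitz constants [>= 1] qualifies, in particular
   [C |-> max 1 (least Lipschitz constant on C)]. *)
Record lipschitz_constants (R : realType) (n : nat) (f : 'rV[R]_n -> R)
    (L1 : set 'rV[R]_n -> R) : Prop := {
  lc_ge1 : forall C : set 'rV[R]_n, compact C -> C `<` setT -> 1 <= L1 C;
  lc_lipschitz : forall C : set 'rV[R]_n, compact C -> C `<` setT ->
    elipschitz (grad f) C (L1 C);
  lc_monotone : forall C1 C2 : set 'rV[R]_n, compact C1 -> compact C2 ->
    C2 `<` setT -> C1 `<=` C2 -> L1 C1 <= L1 C2 }.

Definition gradient_projection (R : realType) (n : nat) (f : 'rV[R]_n -> R)
    (x xbar : 'rV[R]_n) (eta r : R) : 'rV[R]_n :=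
  let y := x - eta *: grad f x in
  if enorm (y - xbar) <= r then y
  else xbar + (r / enorm (y - xbar)) *: (y - xbar).

Definition slo_step (R : realType) (n : nat) (f : 'rV[R]_n -> R)
    (L1 : set 'rV[R]_n -> R) (D : R) (x0 x : 'rV[R]_n) : 'rV[R]_n :=
  gradient_projection f x x0 (L1 (eball x0 D))^-1 D.

(* [slo_from f L1 eps D d x0 k x Ks out]: started at iteration [k] of an epoch
   with initial point [x0] and current iterate [x], the algorithm terminates
   and returns [out]; [Ks] lists, for the current epoch and each later one, the
   index of its last iterate. *)
Inductive slo_from (R : realType) (n : nat) (f : 'rV[R]_n -> R)
    (L1 : set 'rV[R]_n -> R) (eps D d : R) :
    'rV[R]_n -> nat -> 'rV[R]_n -> seq nat -> 'rV[R]_n -> Prop :=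
| slo_return x0 k x :
    enorm (grad f x) < Num.sqrt eps ->
    slo_from f L1 eps D d x0 k x [:: k] x
| slo_new_epoch x0 k x Ks out :
    ~~ (enorm (grad f x) < Num.sqrt eps) ->
    D - d <= enorm (slo_step f L1 D x0 x - x0) <= D ->
    slo_from f L1 eps D d
      (slo_step f L1 D x0 x) 0 (slo_step f L1 D x0 x) Ks out ->
    slo_from f L1 eps D d x0 k x (k.+1 :: Ks) out
| slo_continue x0 k x Ks out :
    ~~ (enorm (grad f x) < Num.sqrt eps) ->
    ~~ (D - d <= enorm (slo_step f L1 D x0 x - x0) <= D) ->
    slo_from f L1 eps D d x0 k.+1 (slo_step f L1 D x0 x) Ks out ->
    slo_from f L1 eps D d x0 k x Ks out.

(* [Ks] is the sequence [K_1; K_2; ...] over all epochs of the run: [size Ks] is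
   the number of epochs, and [sumn Ks] the number of executions of the gradient
   projection subroutine, each costing one gradient evaluation. *)
Definition slo_run (R : realType) (n : nat) (f : 'rV[R]_n -> R)
    (L1 : set 'rV[R]_n -> R) (eps D d : R) (x01 : 'rV[R]_n)
    (Ks : seq nat) (out : 'rV[R]_n) : Prop :=
  slo_from f L1 eps D d x01 0 x01 Ks out.

Lemma slo_from_inv (R : realType) (n : nat) (f : 'rV[R]_n -> R)
    (L1 : set 'rV[R]_n -> R) (eps D d : R) (x0 : 'rV[R]_n) (k : nat)
    (x : 'rV[R]_n) (Ks : seq nat) (out : 'rV[R]_n) :
  slo_from f L1 eps D d x0 k x Ks out ->
  let y := slo_step f L1 D x0 x in
  if enorm (grad f x) < Num.sqrt eps then Ks = [:: k] /\ out = x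
  else if D - d <= enorm (y - x0) <= D then
    exists2 s, Ks = k.+1 :: s & slo_from f L1 eps D d y 0 y s out
  else slo_from f L1 eps D d x0 k.+1 y Ks out.
Proof.
case=> {x0 k x Ks out} /= [x0 k x ->//|x0 k x s o /negbTE -> -> run|].
  by exists s.
by move=> x0 k x s o /negbTE -> /negbTE ->.
Qed.

Lemma slo_from_deterministic (R : realType) (n : nat) (f : 'rV[R]_n -> R)
    (L1 : set 'rV[R]_n -> R) (eps D d : R) (x0 : 'rV[R]_n) (k : nat)
    (x : 'rV[R]_n) (Ks Ks' : seq nat) (out out' : 'rV[R]_n) :
  slo_from f L1 eps D d x0 k x Ks out ->
  slo_from f L1 eps D d x0 k x Ks' out' ->
  Ks = Ks' /\ out = out'.
Proof.
move=> run; elim: run Ks' out'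
  => {x0 k x Ks out} [x0 k x g|x0 k x s o /negbTE g w _ IH
     |x0 k x s o /negbTE g /negbTE w _ IH]
  Ks' out' /slo_from_inv /=.
- by rewrite g => -[-> ->].
- by rewrite g w => -[s' -> /IH[-> ->]].
- by rewrite g w => /IH.
Qed.

Lemma slo_run_deterministic (R : realType) (n : nat) (f : 'rV[R]_n -> R)
    (L1 : set 'rV[R]_n -> R) (eps D d : R) (x01 : 'rV[R]_n)
    (Ks Ks' : seq nat) (out out' : 'rV[R]_n) :
  slo_run f L1 eps D d x01 Ks out -> slo_run f L1 eps D d x01 Ks' out' ->
  Ks = Ks' /\ out = out'.
Proof. exact: slo_from_deterministic. Qed.

(* Main.v *)
Require Import Defs.
From mathcomp Require Import all_boot all_order all_algebra.
From mathcomp Require Import all_classical all_reals all_analysis.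
From mathcomp Require Import ring lra.
Import Order.TTheory GRing.Theory Num.Theory.
Import numFieldNormedType.Exports.
Local Open Scope classical_set_scope.
Local Open Scope ring_scope.

(** Write [s = sqrt eps], [g] for the gradient at the current iterate [x], [L]
    for the Lipschitz constant on the ball of the current epoch, centred at
    [x0], and [p] for the next iterate.

    Within an epoch, the function decreases by at least [s / 2] per unit of
    distance gained from the centre.  If [p] is interior to the ball it is the plain gradient step,
    whose length is [|g| / L], and the descent lemma gives
    [f x - f p >= |g|^2 / (2 L) = |g| / 2 * |p - x|] ([interior_progress]).  If
    [p] is on the boundary, the decrease is still at least
    [|g| / 2 * (D - |x - x0|)] ([boundary_progress]): completing the square in
    the descent lemma bounds [f p] in terms of the distance from [p] to the
    unprojected point, and that distance is at most [|g| / L - (D - |x - x0|)].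
    As [|g| >= s] before termination, telescoping gives
    [s / 2 * |x - x0| <= f x0 - f x] inside an epoch and a decrease of at least
    [s D / 2] over each completed epoch.

    Everything follows from these two facts.  The number of completed epochs is
    at most [2 Delta / (s D)]; the centres stay within [2 Delta / s] of the
    starting point, so every ball used lies in the ball of radius [RT] and every
    [L] is at most [Lmax], the constant of that large ball.  An interior step
    decreases [f] by at least [eps / (2 Lmax)], so there are at most
    [2 Lmax Delta / eps] of them; a boundary step completes an epoch, which
    decreases [f] by at least [s D / 2 >= eps / 4], so there are at most
    [4 Delta / eps] of those.  Since [Lmax >= 1], the total is at most
    [6 Lmax Delta / eps].

    Termination and the counts are obtained together ([slo_from_bounded]), by
    induction on a bound for a potential which each step lowers by at least
    one. *)

(** * Euclidean geometry of row vectors *)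

Definition edot (R : realType) (n : nat) (x y : 'rV[R]_n) : R :=
  \sum_(i < n) x 0 i * y 0 i.

Arguments edot {R n} x y.

Section Euclidean.
Context {R : realType} {n : nat}.
Implicit Types (x y z : 'rV[R]_n) (a : R).

Lemma edotC x y : edot x y = edot y x.
Proof. by apply: eq_bigr => i _; rewrite mulrC. Qed.

Lemma edotDl x y z : edot (x + y) z = edot x z + edot y z.
Proof.
by rewrite -big_split; apply: eq_bigr => i _; rewrite mxE mulrDl.
Qed.

Lemma edotZl a x y : edot (a *: x) y = a * edot x y.
Proof. by rewrite mulr_sumr; apply: eq_bigr => i _; rewrite mxE mulrA. Qed.

Lemma edotDr x y z : edot x (y + z) = edot x y + edot x z.
Proof. by rewrite edotC edotDl !(edotC x). Qed.

Lemma edotZr a x y : edot x (a *: y) = a * edot x y.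
Proof. by rewrite edotC edotZl edotC. Qed.

Lemma edotNl x y : edot (- x) y = - edot x y.
Proof. by rewrite -scaleN1r edotZl mulN1r. Qed.

Lemma edot_ge0 x : 0 <= edot x x.
Proof. by apply: sumr_ge0 => i _; rewrite -expr2 sqr_ge0. Qed.

Lemma enorm_ge0 x : 0 <= enorm x.
Proof. exact: sqrtr_ge0. Qed.

Lemma sqr_enorm x : enorm x ^+ 2 = edot x x.
Proof.
rewrite sqr_sqrtr; first by apply: eq_bigr => i _; rewrite expr2.
by apply: sumr_ge0 => i _; apply: sqr_ge0.
Qed.

Lemma enormZ a x : enorm (a *: x) = `|a| * enorm x.
Proof.
apply/eqP; rewrite -(@eqrXn2 _ 2) ?mulr_ge0 ?enorm_ge0 //.
by rewrite exprMn !sqr_enorm edotZl edotZr real_normK ?num_real // mulrA expr2.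
Qed.

Lemma enorm0 : enorm (0 : 'rV[R]_n) = 0.
Proof. by rewrite -(scale0r 0) enormZ normr0 mul0r. Qed.

Lemma enormN x : enorm (- x) = enorm x.
Proof. by rewrite -scaleN1r enormZ normrN1 mul1r. Qed.

(** Cauchy-Schwarz: the quadratic form [(s, t) |-> |s x + t y|^2] is
    nonnegative, so its discriminant is nonpositive. *)
Lemma edot_le_enorm x y : edot x y <= enorm x * enorm y.
Proof.
have quad s t : 0 <= s ^+ 2 * edot x x + 2 * s * t * edot x y
                     + t ^+ 2 * edot y y.
  have := edot_ge0 (s *: x + t *: y).
  rewrite !(edotDl, edotDr) !(edotZl, edotZr) (edotC y x).
  by congr (0 <= _); ring.
have ca : edot x y ^+ 2 <= edot x x * edot y y.
  have := edot_ge0 y; rewrite le0r => /predU1P[b0|b_gt0].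
    (* The form is then affine in [t]: this [t] makes the value [- c^2]. *)
    have := quad (- edot x y) ((edot x x + 1) / 2).
    rewrite b0; set c := edot x y; set a := edot x x => h; lra.
  move: b_gt0 (quad (edot y y) (- edot x y)).
  set c := edot x y; set a := edot x x; set b := edot y y => b_gt0 h.
  rewrite -subr_ge0 -(pmulr_rge0 _ b_gt0); lra.
apply: (le_trans (ler_norm _)); rewrite -(@ler_pXn2r _ 2) ?nnegrE //.
- by rewrite exprMn !sqr_enorm real_normK ?num_real.
- by rewrite mulr_ge0 ?enorm_ge0.
Qed.

Lemma enormD x y : enorm (x + y) <= enorm x + enorm y.
Proof.
rewrite -(@ler_pXn2r _ 2) ?nnegrE ?addr_ge0 ?enorm_ge0 //.
rewrite sqrrD !sqr_enorm !(edotDl, edotDr) (edotC y x).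
have := edot_le_enorm x y; lra.
Qed.

Lemma enorm_dist_triangle x y z :
  enorm (x - z) <= enorm (x - y) + enorm (y - z).
Proof. by rewrite -{1}(subrK y x) -addrA enormD. Qed.

Lemma enorm_coord x i : `|x 0 i| <= enorm x.
Proof.
rewrite -(@ler_pXn2r _ 2) ?nnegrE ?enorm_ge0 // real_normK ?num_real //.
rewrite sqr_enorm /edot (bigD1 i) //= -expr2 lerDl.
by apply: sumr_ge0 => j _; rewrite -expr2 sqr_ge0.
Qed.

Lemma eball_convex x0 D x y t : eball x0 D x -> eball x0 D y -> 0 <= t <= 1 ->
  eball x0 D (x + t *: (y - x)).
Proof.
rewrite /eball /= => xD yD /andP[t0 t1].
have -> : x + t *: (y - x) - x0 = (1 - t) *: (x - x0) + t *: (y - x0).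
  by rewrite !scalerBl !scalerBr scale1r; apply/rowP => i; rewrite !mxE; ring.
apply: (le_trans (enormD _ _)); rewrite !enormZ !ger0_norm ?subr_ge0 //.
nra.
Qed.

Lemma enorm_continuous : continuous (@enorm R n).
Proof.
move=> x; apply: continuous_comp; last exact: sqrt_continuous.
apply: (@cvg_big _ _ _ _ _ add_continuous _ (nbhs x)) => i _.
have h : (fun M : 'rV[R]_n => M 0 i) @ x --> x 0 i by exact: coord_continuous.
exact: (cvg_comp _ _ h (@exprn_continuous R 2 (x 0 i))).
Qed.

(** The topology is that of the sup norm, hence the detour through the
    comparison of the two norms and the continuity of [enorm]. *)
Lemma eball_compact x0 D : compact (eball x0 D).
Proof.
apply: bounded_closed_compact.
- exists (D + enorm x0); split; first exact: num_real.
  move=> M /ltW DM y yD; apply: le_trans DM.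
  have : enorm y <= D + enorm x0.
    by rewrite -{1}(subrK x0 y) (le_trans (enormD _ _)) // lerD2r.
  apply: le_trans; rewrite [`|y|]mx_normrE.
  apply/bigmax_leP; split => [|[i j] _ /=]; first exact: enorm_ge0.
  by rewrite ord1 enorm_coord.
- have -> : eball x0 D = (fun y => enorm (y - x0)) @^-1` [set r | r <= D] by [].
  apply: preimage_closed; last exact: closed_le.
  move=> y _; apply: continuous_comp; last exact: enorm_continuous.
  exact: (cvgB cvg_id (cvg_cst x0)).
Qed.

Lemma eball_proper x0 D : (0 < n)%N -> eball x0 D `<` setT.
Proof.
move=> n_gt0; split => // /(_ (x0 + const_mx (`|D| + 1)) I).
rewrite /eball /= addrC addKr => h.
have := le_trans (enorm_coord _ (Ordinal n_gt0)) h.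
have := ler_norm D; have := normr_ge0 D.
by rewrite mxE [`|_ + 1|]ger0_norm ?addr_ge0 //; lra.
Qed.

End Euclidean.

(** * Descent lemma *)

Section Descent.
Context {R : realType} {n : nat}.
Implicit Types (f : 'rV[R]_n -> R) (x y : 'rV[R]_n).

Lemma derive_edot f x v : differentiable f x -> 'D_v f x = edot (grad f x) v.
Proof.
move=> df; rewrite deriveE // {1}(row_sum_delta v) linear_sum.
by apply: eq_bigr => i _; rewrite linearZ /= mxE deriveE // mulrC.
Qed.

(** The difference quotient of [f] along the line is literally the one defining
    the directional derivative of [f] at [x + t *: v]. *)
Lemma is_derive_line f x v (t : R) : differentiable f (x + t *: v) ->
  is_derive t (1 : R) (fun s : R => f (x + s *: v))
    (edot (grad f (x + t *: v)) v).
Proof.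
move=> df; rewrite -derive_edot //.
have E : (fun h : R => h^-1 *:
      (((fun s : R => f (x + s *: v)) \o shift t) (h *: 1) - f (x + t *: v)))
  = (fun h : R => h^-1 *:
      ((f \o shift (x + t *: v)) (h *: v) - f (x + t *: v))).
  apply/funext => h /=; congr (_ *: (f _ - _)).
  by rewrite scalerDl [h *: 1]mulr1 addrCA.
have dv := @diff_derivable _ _ _ f (x + t *: v) v df.
split; first by rewrite /derivable E.
by rewrite /derive E.
Qed.

(** By Cauchy-Schwarz and the Lipschitz bound, the gap between [f] and the
    quadratic model has nonpositive derivative along the segment, so the mean
    value theorem applies. *)
Lemma descent_lemma f (C : set 'rV[R]_n) L x y :
  (forall z, differentiable f z) -> elipschitz (grad f) C L ->
  (forall t : R, 0 <= t <= 1 -> C (x + t *: (y - x))) ->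
  f y <= f x + edot (grad f x) (y - x) + L / 2 * enorm (y - x) ^+ 2.
Proof.
move=> df lipC seg; set v := y - x.
pose phi := fun t : R => f (x + t *: v)
  - (t * edot (grad f x) v + t ^+ 2 * (L / 2 * enorm v ^+ 2)).
pose dphi := fun t : R => edot (grad f (x + t *: v)) v
  - (edot (grad f x) v + 2 * t * (L / 2 * enorm v ^+ 2)).
have phiP t : is_derive t (1 : R) phi (dphi t).
  have dt : is_derive t (1 : R) (fun s : R => f (x + s *: v)) _ :=
    is_derive_line f x v t (df _).
  rewrite /phi /dphi; apply: is_deriveB; apply: is_derive_eq.
  rewrite /GRing.scale /=; ring.
have cphi : {within `[0, 1], continuous phi}.
  apply: derivable_within_continuous => t _.
  exact: @ex_derive _ _ _ _ _ _ _ (phiP t).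
have [c /[!in_itv] /= /andP[c0 c1] E] :=
  @MVT R phi dphi 0 1 ltr01 (fun t _ => phiP t) cphi.
have : phi 1 - phi 0 <= 0.
  rewrite E subr0 mulr1 /dphi.
  have C0 : C x by have := seg 0; rewrite scale0r addr0 lexx ler01; apply.
  have Cc : C (x + c *: v) by apply: seg; rewrite !ltW.
  have := lipC _ _ Cc C0; rewrite [_ + c *: v - x]addrAC subrr add0r.
  rewrite enormZ ger0_norm ?(ltW c0) // => h.
  have := edot_le_enorm (grad f (x + c *: v) - grad f x) v.
  rewrite edotDl edotNl.
  have := ler_wpM2r (enorm_ge0 v) h.
  lra.
rewrite /phi scale0r addr0 scale1r [x + v]addrC /v subrK.
lra.
Qed.

End Descent.

(** * Progress of one gradient projection step *)

Section GradientProjectionStep.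
Context {R : realType} {n : nat} (f : 'rV[R]_n -> R) (x0 x : 'rV[R]_n).
Context (L D : R) (D_gt0 : 0 < D) (L_gt0 : 0 < L).
Context (diff_f : forall z, differentiable f z).
Context (lip_f : elipschitz (grad f) (eball x0 D) L).
Context (x_ball : enorm (x - x0) <= D).

Let z := x - L^-1 *: grad f x.
Let p := gradient_projection f x x0 L^-1 D.

Lemma gradient_projection_cases :
  (enorm (z - x0) <= D /\ p = z) \/
  [/\ D < enorm (z - x0), enorm (p - x0) = D
    & enorm (p - z) = enorm (z - x0) - D].
Proof.
rewrite /p /gradient_projection -/z; case: leP => [|lt_D]; first by left.
right; have N_gt0 := lt_trans D_gt0 lt_D; split=> //.
  rewrite addrAC subrr add0r enormZ ger0_norm ?divr_ge0 ?ltW //.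
  by rewrite divfK ?gt_eqF.
have -> : x0 + (D / enorm (z - x0)) *: (z - x0) - z
    = (D / enorm (z - x0) - 1) *: (z - x0).
  by rewrite scalerBl scale1r [- (z - x0)]opprB [RHS]addrCA addrA.
rewrite enormZ ler0_norm ?subr_le0 ?ler_pdivrMr ?mul1r ?(ltW lt_D) //.
by rewrite opprB mulrBl mul1r divfK ?gt_eqF.
Qed.

Lemma gradient_projection_in_eball : enorm (p - x0) <= D.
Proof. by case: gradient_projection_cases => [[zD ->]//|[_ -> _]]. Qed.

Lemma enorm_gradient_step : enorm (z - x) = enorm (grad f x) / L.
Proof.
by rewrite /z addrAC subrr add0r enormN enormZ gtr0_norm ?invr_gt0 // mulrC.
Qed.

(** The quadratic model of the descent lemma, with the square completed: its
    unconstrained minimizer is the gradient step [z]. *)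
Lemma gradient_projection_descent :
  f p <= f x + L / 2 * enorm (p - z) ^+ 2 - enorm (grad f x) ^+ 2 / (2 * L).
Proof.
apply: le_trans (descent_lemma f _ L x p diff_f lip_f _) _.
  by move=> t; apply: eball_convex => //; exact: gradient_projection_in_eball.
have -> : p - z = (p - x) + L^-1 *: grad f x by rewrite /z opprB addrA addrAC.
rewrite !sqr_enorm !(edotDl, edotDr) !(edotZl, edotZr) -!(edotC (grad f x)).
by rewrite le_eqVlt; apply/orP; left; apply/eqP; field; rewrite gt_eqF.
Qed.

(** A projected point lies on the boundary, so an interior [p] is the gradient
    step itself. *)
Lemma interior_progress : enorm (p - x0) < D ->
  enorm (p - x) = enorm (grad f x) / L /\
  f p <= f x - enorm (grad f x) ^+ 2 / (2 * L).
Proof.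
have := gradient_projection_descent.
case: gradient_projection_cases => [[_ ->]|[_ -> _] _]; last by rewrite ltxx.
by rewrite enorm_gradient_step subrr enorm0 expr0n mulr0 addr0.
Qed.

(** The gradient step must cover at least the distance [D - |x - x0|] to reach
    the boundary, and what it overshoots, which bounds [|p - z|], is at most
    [|g| / L - (D - |x - x0|)] by the triangle inequality. *)
Lemma boundary_progress : D <= enorm (p - x0) ->
  f p <= f x - enorm (grad f x) / 2 * (D - enorm (x - x0)).
Proof.
move=> pD; have := gradient_projection_descent.
have := enorm_dist_triangle z x x0; rewrite enorm_gradient_step.
set G := enorm (grad f x); set l := enorm (x - x0).
set q := enorm (p - z) => tri fp.
have [q_ge0 G_ge0] : 0 <= q /\ 0 <= G by rewrite !enorm_ge0.
have ql : q <= G / L - (D - l).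
  rewrite /q; case: gradient_projection_cases => [[zD E]|[_ _ ->]]; last lra.
  by rewrite E in pD *; rewrite subrr enorm0; lra.
have l_ge0 : 0 <= D - l by rewrite subr_ge0.
set e := D - l in ql l_ge0 *.
have q2 : q ^+ 2 <= (G / L - e) ^+ 2.
  by rewrite ler_pXn2r // nnegrE; lra.
have h1 : L / 2 * q ^+ 2 <= L / 2 * (G / L - e) ^+ 2.
  by rewrite ler_pM2l // divr_gt0.
have h2 : L / 2 * (G / L - e) ^+ 2 - G ^+ 2 / (2 * L)
    = - (G / 2 * e) - L * e / 2 * (G / L - e).
  by field; rewrite gt_eqF.
have h3 : 0 <= L * e / 2 * (G / L - e).
  by rewrite mulr_ge0 ?divr_ge0 ?mulr_ge0 ?(ltW L_gt0) //; lra.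
lra.
Qed.

End GradientProjectionStep.

(** * Termination and counting *)

Section Run.
Context {R : realType} {n : nat} (f : 'rV[R]_n -> R) (L1 : set 'rV[R]_n -> R).
Context (eps D fmin Lmax : R) (x01 : 'rV[R]_n).
Let s := Num.sqrt eps.
Context (n_gt0 : (0 < n)%N) (eps_gt0 : 0 < eps) (D_gt0 : 0 < D).
Context (D_ge : s / 2 <= D) (diff_f : forall z, differentiable f z).
Context (L1P : lipschitz_constants f L1) (f_ge : forall z, fmin <= f z).
Context (L1_le : forall x0, s / 2 * enorm (x0 - x01) <= f x01 - f x0 ->
  L1 (eball x0 D) <= Lmax).

(** The two terms bound the numbers of future interior steps and of future
    epoch changes: the former lower [f x] by at least [eps / (2 Lmax)], the
    latter lower the value of [f] at the centre by at least [eps / 4]. *)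
Let potential x0 x : R :=
  2 * Lmax / eps * (f x - fmin) + 4 / eps * (f x0 - fmin).

(** The first two hypotheses on the state are the telescoped forms of the rate
    of decrease, across the past epochs and inside the current one.  The bound
    on [size Ks] counts the completed epochs, each of which lowers [f] by at
    least [s * D / 2]; the last epoch is never completed. *)
Lemma slo_from_bounded (m : nat) x0 k x :
  s / 2 * enorm (x0 - x01) <= f x01 - f x0 ->
  s / 2 * enorm (x - x0) <= f x0 - f x ->
  enorm (x - x0) <= D ->
  potential x0 x < m%:R ->
  exists (Ks : seq nat) (out : 'rV[R]_n),
    [/\ slo_from f L1 eps D 0 x0 k x Ks out,
        s * D / 2 * ((size Ks)%:R - 1) <= f x0 - fmin,
        enorm (grad f out) < s
      & (sumn Ks)%:R <= k%:R + potential x0 x].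
Proof.
have s_gt0 : 0 < s by rewrite sqrtr_gt0.
have s2 : s ^+ 2 = eps by rewrite sqr_sqrtr ?ltW.
have L1_ge1 y : 1 <= L1 (eball y D).
  by apply: (lc_ge1 L1P); [exact: eball_compact|exact: eball_proper].
elim: m x0 k x => [|m IH] x0 k x inv0 inv xD pot_lt.
all: have LD_le := L1_le x0 inv0; have LD_ge1 := L1_ge1 x0.
all: have Lmax_gt0 : 0 < Lmax
  by exact: lt_le_trans ltr01 (le_trans LD_ge1 LD_le).
all: have a_ge0 : 0 <= 2 * Lmax / eps by rewrite divr_ge0 ?mulr_ge0 ?ltW.
all: have b_ge0 : 0 <= 4 / eps by rewrite divr_ge0 ?ltW.
all: have pot_ge0 : 0 <= potential x0 x
  by rewrite addr_ge0 // mulr_ge0 // subr_ge0.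
  by move: pot_lt; rewrite ltNge pot_ge0.
have [small|large] := boolP (enorm (grad f x) < s).
  exists [:: k], x; split => //.
  - exact: slo_return.
  - by rewrite subrr mulr0 subr_ge0.
  - by rewrite /= addn0 lerDl.
have LD_gt0 : 0 < L1 (eball x0 D) by exact: lt_le_trans ltr01 LD_ge1.
have lipD : elipschitz (grad f) (eball x0 D) (L1 (eball x0 D)).
  by apply: (lc_lipschitz L1P); [exact: eball_compact|exact: eball_proper].
pose p := slo_step f L1 D x0 x.
have pD : enorm (p - x0) <= D by exact: gradient_projection_in_eball.
have Gs : s <= enorm (grad f x) by rewrite leNgt.
have [bdry|inner] := leP D (enorm (p - x0)).
- have fp := boundary_progress f x0 x _ D D_gt0 LD_gt0 diff_f lipD xD bdry.
  rewrite -/(slo_step f L1 D x0 x) -/p in fp.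
  have fp' : f p <= f x - s / 2 * (D - enorm (x - x0)).
    have : s / 2 * (D - enorm (x - x0))
        <= enorm (grad f x) / 2 * (D - enorm (x - x0)).
      by rewrite ler_wpM2r ?subr_ge0 // ler_pM2r.
    lra.
  have fpx : f p <= f x.
    apply: le_trans fp' _; rewrite lerBlDr lerDl.
    by rewrite mulr_ge0 ?subr_ge0 // divr_ge0 // ltW.
  have fp0 : f p <= f x0 - s / 2 * D by lra.
  have inv0' : s / 2 * enorm (p - x01) <= f x01 - f p.
    have : s / 2 * enorm (p - x01) <= s / 2 * (D + enorm (x0 - x01)).
      rewrite ler_pM2l ?divr_gt0 //.
      by apply: le_trans (enorm_dist_triangle p x0 x01) _; rewrite lerD2r.
    lra.
  have pp0 : enorm (p - p) = 0.
    by rewrite subrr enorm0.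
  (* The second term alone pays for the step: [s * D / 2 >= eps / 4]. *)
  have pot_dec : potential p p + 1 <= potential x0 x.
    have h1 : 2 * Lmax / eps * (f p - fmin) <= 2 * Lmax / eps * (f x - fmin).
      by rewrite ler_wpM2l // lerD2r.
    have h2 : 4 / eps * (f p - fmin) <= 4 / eps * (f x0 - fmin - s / 2 * D).
      by rewrite ler_wpM2l //; lra.
    have h3 : 1 <= 4 / eps * (s / 2 * D).
      have : s / 2 * (s / 2) <= s / 2 * D by rewrite ler_pM2l ?divr_gt0.
      move/(ler_wpM2l b_ge0); apply: le_trans.
      rewrite -s2 le_eqVlt; apply/orP; left; apply/eqP.
      by field; rewrite gt_eqF.
    rewrite /potential; lra.
  have [] := IH p 0%N p inv0'; rewrite ?pp0 ?mulr0 ?subrr ?(ltW D_gt0) //.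
    by move: pot_lt; rewrite -[m.+1%:R]natr1; lra.
  move=> Ks [out [run sz small sm]].
  exists (k.+1 :: Ks), out; split=> //.
  + by apply: slo_new_epoch => //; rewrite subr0 -/p bdry.
  + rewrite /= -[(size Ks).+1%:R]natr1 addrK; move: sz; lra.
  + rewrite /= natrD -[k.+1%:R]natr1; move: sm; rewrite add0r; lra.
- have [px fp] :=
    interior_progress f x0 x _ D D_gt0 LD_gt0 diff_f lipD xD inner.
  rewrite -/(slo_step f L1 D x0 x) -/p in px fp.
  set G := enorm (grad f x) in Gs px fp *.
  set L := L1 (eball x0 D) in LD_gt0 LD_le px fp *.
  have step_dec : s / 2 * enorm (p - x) <= f x - f p.
    have : s / 2 * (G / L) <= G / 2 * (G / L).
      by rewrite ler_wpM2r ?ler_pM2r // divr_ge0 ?enorm_ge0 ?ltW.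
    have -> : G / 2 * (G / L) = G ^+ 2 / (2 * L) by field; rewrite gt_eqF.
    rewrite px; lra.
  have inv' : s / 2 * enorm (p - x0) <= f x0 - f p.
    have tri := enorm_dist_triangle p x x0.
    have : s / 2 * enorm (p - x0) <= s / 2 * (enorm (p - x) + enorm (x - x0)).
      by rewrite ler_pM2l ?divr_gt0.
    lra.
  have pot_dec : potential x0 p + 1 <= potential x0 x.
    have h1 : eps / (2 * Lmax) <= f x - f p.
      apply: (@le_trans _ _ (G ^+ 2 / (2 * L))); last lra.
      rewrite -s2 ler_pM ?sqr_ge0 ?invr_ge0 ?mulr_ge0 ?(ltW Lmax_gt0) //.
        by rewrite ler_pXn2r // nnegrE ?enorm_ge0 ?ltW.
      by rewrite lef_pV2 ?posrE ?mulr_gt0 // ler_pM2l.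
    have := ler_wpM2l a_ge0 h1.
    have -> : 2 * Lmax / eps * (eps / (2 * Lmax)) = 1 by field; rewrite !gt_eqF.
    rewrite /potential; lra.
  have [] := IH x0 k.+1 p inv0 inv' pD.
    by move: pot_lt; rewrite -[m.+1%:R]natr1; lra.
  move=> Ks [out [run sz small sm]].
  exists Ks, out; split=> //.
  + apply: slo_continue => //; rewrite subr0 -/p.
    by rewrite negb_and -ltNge inner.
  + by move: sm; rewrite -[k.+1%:R]natr1; lra.
Qed.

End Run.

Theorem theorem2p8 (R : realType) :
  exists2 c : R, 0 < c &
  forall (n : nat) (f : 'rV[R]_n -> R) (L1 : set 'rV[R]_n -> R)
    (x01 : 'rV[R]_n) (eps D : R),
  standing_assumption f ->
  lipschitz_constants f L1 ->
  0 < eps -> 0 < D -> Num.sqrt eps / 2 <= D ->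
  let Delta := f x01 - inf (range f) in
  let RT := 4 * Delta / Num.sqrt eps + D in
  let T := Num.ceil (4 * Delta / (Num.sqrt eps * D) + 1) in
  exists (Ks : seq nat) (out : 'rV[R]_n),
    [/\ slo_run f L1 eps D 0 x01 Ks out,
        (size Ks)%:Z <= T,
        enorm (grad f out) ^+ 2 <= eps
      & (sumn Ks)%:R <= c * (Delta / eps * L1 (eball x01 RT))].
Proof.
exists 6 => // n f L1 x01 eps D sa lc eps_gt0 D_gt0 D_ge Delta RT T.
(* The hypotheses on the constants concern proper subsets only, and balls are
   proper in positive dimension; in dimension 0 every map is Lipschitz. *)
have n_gt0 : (0 < n)%N.
  rewrite lt0n; apply/eqP => n0; case: (sa_not_lipschitz sa); exists 0.
  move=> x y _ _; rewrite mul0r /enorm big1 ?sqrtr0 // => i _.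
  by have := ltn_ord i; rewrite [X in (_ < X)%N]n0.
have s_gt0 : 0 < Num.sqrt eps by rewrite sqrtr_gt0.
have f_ge z : inf (range f) <= f z.
  by apply: (ge_inf (sa_bounded_below sa)); exists z.
have Delta_ge0 : 0 <= Delta by rewrite subr_ge0.
have RT_proper := eball_proper x01 RT n_gt0.
have LT_ge1 : 1 <= L1 (eball x01 RT).
  by apply: (lc_ge1 lc) => //; exact: eball_compact.
(* Centres satisfying the invariant are within [2 * Delta / s] of [x01]. *)
have L1_le x0 : Num.sqrt eps / 2 * enorm (x0 - x01) <= f x01 - f x0 ->
    L1 (eball x0 D) <= L1 (eball x01 RT).
  move=> h; apply: (lc_monotone lc) => //; try exact: eball_compact.
  move=> y yD; apply: le_trans (enorm_dist_triangle y x0 x01) _.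
  rewrite addrC lerD //.
  have h2 : Num.sqrt eps / 2 * enorm (x0 - x01) <= Delta.
    by apply: le_trans h _; rewrite lerD2l lerN2.
  rewrite ler_pdivlMr //; lra.
have [|||Ks [out [run sz small sm]]] := slo_from_bounded f L1 eps D _ _ x01
  n_gt0 eps_gt0 D_gt0 D_ge (sa_differentiable sa) lc f_ge L1_le
  _ x01 0%N x01 _ _ _ (truncnS_gt _).
- by rewrite !subrr enorm0 mulr0.
- by rewrite !subrr enorm0 mulr0.
- by rewrite !subrr enorm0 ltW.
exists Ks, out; split=> //.
- rewrite -(ler_int R); apply: le_trans (ceil_ge _).
  rewrite -[_%:~R]/((size Ks)%:R) -lerBlDr ler_pdivlMr ?mulr_gt0 //.
  move: sz; rewrite -/Delta; lra.
- rewrite -[leRHS](@sqr_sqrtr _ eps) ?(ltW eps_gt0) //.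
  by rewrite ler_pXn2r ?nnegrE ?enorm_ge0 // ltW.
- apply: le_trans sm _; rewrite add0r -/Delta.
  have : 0 <= Delta / eps by rewrite divr_ge0 // ltW.
  set A := Delta / eps; set l := L1 _ in LT_ge1 *.
  have -> : 2 * l / eps * Delta + 4 / eps * Delta = 2 * l * A + 4 * A.
    by rewrite /A; field; rewrite gt_eqF.
  by move=> A_ge0; have := ler_wpM2l A_ge0 LT_ge1; lra.
Qed.
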